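(* Let $d_1>d_2\ge1$ be integers, let $\boldsymbol\Sigma_{\boldsymbol\varepsilon}\in\mathbb R^{(d_1-d_2)\times(d_1-d_2)}$ be positive definite, and let $\tilde{\boldsymbol G}_h:[0,1]^{d_2}\to\mathbb R^{d_1-d_2}$ ($h>0$) be such that there exists $0\le L<\infty$ with $$\left\|\frac{\partial^{|u|}\tilde{\boldsymbol G}_h}{\prod_{j\in u}\partial z_j}(\boldsymbol z)\right\|_2\le L\quad\text{for all }\boldsymbol z\in[0,1]^{d_2},\ u\subseteq\{1,\dots,d_2\},$$ and $\|\tilde{\boldsymbol G}_h(\boldsymbol z)-\tilde{\boldsymbol G}_h(\boldsymbol z')\|_2\le L\|\boldsymbol z-\boldsymbol z'\|_2$ for $\boldsymbol z,\boldsymbol z'\in[0,1]^{d_2}$. For $TOL>0$ and $p>0$ let $c(TOL)=(2(1+p))^{1/2}\log(TOL^{-1})^{1/2}$, let $F^{-1}_{c(TOL)}$ be the inverse CDF of the standard normal distribution truncated to $[-c(TOL),c(TOL)]$ (applied componentwise), and let $$g_h(\boldsymbol y,\boldsymbol x)=\frac{1}{\det(2\pi\boldsymbol\Sigma_{\boldsymbol\varepsilon})^{1/2}}\exp\left(-\frac12\left\|\tilde{\boldsymbol G}_h(\boldsymbol y_1)+\boldsymbol\Sigma_{\boldsymbol\varepsilon}^{1/2}F^{-1}_{c(TOL)}(\boldsymbol y_2)-\tilde{\boldsymbol G}_h(\boldsymbol x)\right\|^2_{\boldsymbol\Sigma_{\boldsymbol\varepsilon}^{-1}}\right)$$ for $\boldsymbol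 y=(\boldsymbol y_1,\boldsymbol y_2)$, $\boldsymbol y_1,\boldsymbol x\in[0,1]^{d_2}$, $\boldsymbol y_2\in[0,1]^{d_1-d_2}$, and $\bar g_h(\boldsymbol y)=\int_{[0,1]^{d_2}}g_h(\boldsymbol y,\boldsymbol x)\,\mathrm d\boldsymbol x$. Then there exists $0\le\tilde L<\infty$, not depending on $TOL$, such that for every fixed and sufficiently large value of $c(TOL)$, $$\sup_{\boldsymbol y\in[0,1]^{d_1}}\left|\frac{V_{\mathrm{HK}}(g_h(\boldsymbol y,\cdot))}{\bar g_h(\boldsymbol y)}\right|\le\tilde L^{d_2}c(TOL)^{d_2}.$$
   Context: $\Phi$ is the standard normal CDF, and $F^{-1}_{c}(y)=\Phi^{-1}\big((2\Phi(c)-1)y+(1-\Phi(c))\big)$ for $y\in[0,1]$. $\|\boldsymbol v\|^2_{\boldsymbol\Sigma^{-1}}=\boldsymbol v^{\top}\boldsymbol\Sigma^{-1}\boldsymbol v$. For $u=\emptyset$ the mixed derivative is the function itself. Hardy--Krause variation. For $\varphi:[0,1]^d\to\mathbb R$ with continuous mixed first-order derivatives, recursively $V_{\mathrm{HK}}(\varphi)=\int_{[0,1]^d}\left|\frac{\partial^d\varphi}{\partial z_1\cdots\partial z_d}(\boldsymbol z)\right|\mathrm d\boldsymbol z+\sum_{i=1}^dV_{\mathrm{HK}}(\varphi|_{z_i=1})$, where $\varphi|_{z_i=1}:[0,1]^{d-1}\to\mathbb R$ is the restriction, and for $d=1$, $V_{\mathrm{HK}}(\varphi)=\int_0^1|\varphi'(z)|\,\mathrm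 dz$. *)

(* Defs.v *)
From mathcomp Require Import all_boot all_order all_algebra.
From mathcomp Require Import all_classical all_reals all_analysis.
Set Implicit Arguments.
Unset Strict Implicit.
Unset Printing Implicit Defensive.
Import Order.TTheory GRing.Theory Num.Theory.
Import numFieldNormedType.Exports.
Local Open Scope classical_set_scope.
Local Open Scope ring_scope.

Section LinearAlgebra.
Context {R : realType}.

Definition norm2 n (v : 'cV[R]_n) : R := Num.sqrt (\sum_(i < n) v i 0 ^+ 2).

Definition posdefmx n (S : 'M[R]_n) : Prop :=
  S^T = S /\ forall v : 'cV[R]_n, v != 0 -> 0 < (v^T *m S *m v) 0 0.

(* The principal square root: for positive definite [S] exactly one matrix
   satisfies the condition, so the default value 0 is not used. *)
Definition sqrtmx n (S : 'M[R]_n) : 'M[R]_n :=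
  xget 0 [set T : 'M[R]_n | posdefmx T /\ T *m T = S].

Definition wnorm2 n (S : 'M[R]_n) (v : 'cV[R]_n) : R :=
  (v^T *m invmx S *m v) 0 0.

End LinearAlgebra.

Section Cube.
Context {R : realType}.

Definition cube d : set 'cV[R]_d := [set z | forall i, 0 <= z i 0 <= 1].
Arguments cube d _ : clear implicits.

(* Iterated Lebesgue integral over [0,1]^d. It is only applied to nonnegative
   functions, for which it is the d-dimensional integral by Tonelli. *)
Fixpoint int_cube d : ('cV[R]_d -> \bar R) -> \bar R :=
  match d with
  | 0 => fun f => f 0
  | d'.+1 => fun f =>
      (\int[lebesgue_measure]_(t in `[0%R, 1%R])
         int_cube (fun w : 'cV[R]_d' => f (col_mx (t%:M : 'cV[R]_1) w)))%E
  end.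

Definition face1 d (i : 'I_d.+1) (w : 'cV[R]_d) : 'cV[R]_d.+1 :=
  \col_j (if unlift i j is Some k then w k 0 else 1).

Section PartialDerivatives.
Context {V : normedModType R} {d : nat}.
Implicit Types (f : 'cV[R]_d -> V) (j : 'I_d) (z : 'cV[R]_d).

(* Increments are restricted to those for which the j-th coordinate stays in
   [0,1]: only the values of [f] on the cube matter, and derivatives on the
   boundary are one-sided. *)
Definition incr_cube j z : set_system R :=
  within [set t | 0 <= z j 0 + t <= 1] 0^'.

Definition diff_quot f j z (t : R) : V :=
  t^-1 *: (f (z + t *: delta_mx j 0) - f z).

Definition pderivable f j z : Prop := cvg (diff_quot f j z @ incr_cube j z).

Definition pderiv j f z : V := lim (diff_quot f j z @ incr_cube j z).

(* [pderivs [:: j1; ...; jk] f] is d/dz_j1 (... (d/dz_jk f)). *)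
Definition pderivs (s : seq 'I_d) f : 'cV[R]_d -> V := foldr pderiv f s.

Fixpoint pderivs_exist (s : seq 'I_d) f : Prop :=
  if s is j :: s' then
    pderivs_exist s' f /\
    forall z, cube d z -> pderivable (pderivs s' f) j z
  else True.

(* [enum u] lists [u] in increasing order. *)
Definition mixed_deriv (u : {set 'I_d}) f := pderivs (enum u) f.

Definition mixed_deriv_exists (u : {set 'I_d}) f := pderivs_exist (enum u) f.

End PartialDerivatives.

(* Starting the recursion with 0 in dimension 0 gives the integral of
   |phi'| in dimension 1. *)
Fixpoint V_HK d : ('cV[R]_d -> R) -> \bar R :=
  match d with
  | 0 => fun=> 0%E
  | d'.+1 => fun phi =>
      (int_cube (fun z => `|mixed_deriv [set: 'I_d'.+1] (phi : _ -> R^o) z|%:E)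
       + \sum_(i < d'.+1) V_HK (fun w => phi (face1 i w)))%E
  end.

End Cube.

Arguments cube {R} d _.

Section TruncatedNormal.
Context {R : realType}.

Definition Phi (x : R) : R := fine (normal_prob (0 : R) 1 `]-oo, x]).

(* [Phi] is a bijection from R to ]0,1[; the default value concerns only
   arguments outside ]0,1[. *)
Definition Phi_inv (q : R) : R := xget 0 [set x | Phi x = q].

Definition Finv (c y : R) : R := Phi_inv ((2 * Phi c - 1) * y + (1 - Phi c)).

Definition c_of (p TOL : R) : R := Num.sqrt (2 * (1 + p)) * Num.sqrt (ln TOL^-1).

End TruncatedNormal.

Section Integrand.
Context {R : realType} {d1 d2 : nat} (le_d : (d2 <= d1)%N).

Definition split_pt (y : 'cV[R]_d1) : 'cV[R]_(d2 + (d1 - d2)) :=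
  castmx (esym (subnKC le_d), erefl) y.
Definition pt1 (y : 'cV[R]_d1) : 'cV[R]_d2 := usubmx (split_pt y).
Definition pt2 (y : 'cV[R]_d1) : 'cV[R]_(d1 - d2) := dsubmx (split_pt y).

Variables (S : 'M[R]_(d1 - d2)) (G : 'cV[R]_d2 -> 'cV[R]_(d1 - d2)) (c : R).

Definition g (y : 'cV[R]_d1) (x : 'cV[R]_d2) : R :=
  (Num.sqrt (\det ((2 * pi) *: S)))^-1 *
  expR (- (1 / 2) *
    wnorm2 S (G (pt1 y) + sqrtmx S *m map_mx (Finv c) (pt2 y) - G x)).

Definition gbar (y : 'cV[R]_d1) : \bar R := int_cube (fun x => (g y x)%:E).

End Integrand.

(* Main.v *)
Require Import Defs.
From mathcomp Require Import all_boot all_order all_algebra.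
From mathcomp Require Import all_classical all_reals all_analysis.
From mathcomp Require Import ring lra zify.
Set Implicit Arguments.
Unset Strict Implicit.
Unset Printing Implicit Defensive.
Import Order.TTheory GRing.Theory Num.Theory.
Import numFieldNormedType.Exports.
Local Open Scope classical_set_scope.
Local Open Scope ring_scope.

(** Write the integrand as a constant times [expR (exponent a x)], where
[a = G y1 + Sigma^(1/2) Finv c y2].  The truncation gives [|Finv c| <= c], so
[|a|] is at most a constant times [c] once [1 <= c].  Expanding the square,
the term of order [c ^ 2] does not depend on [x]; what is left, [exponent a],
is affine in [a], and since the mixed derivatives of [G] are bounded by [L],
[exponent a] and all its mixed derivatives are at most [K = C * c], with [C]
independent of [c], [h] and [y].  The same [K] is a Lipschitz constant of
[exponent a] in each coordinate ([exponent_bounded], [exponent_lip]).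

Hence each derivative of [g] costs a factor [K] relative to [g] itself:
[|d_u g| <= B * K ^ |u| * g] pointwise ([pderivs_mul_expR_le]).  On the whole
cube this bounds the top-order term of the Hardy-Krause variation by
[B * K ^ d] times the integral of [g], which is [gbar].  A face [z_i = 1] has
only [d - 1] derivatives but its integral of [g] has to be compared with the
integral over the whole cube.  As [log g] is [K]-Lipschitz, moving a distance
[1 / K] away from the face changes [g] by a factor at most [e], so the
integral over the face is at most [e * K] times the integral over the cube
([le_int_cube_face1]).  The missing derivative is thus paid for by this factor
[K], and by induction on the dimension the whole variation is at most a
constant times [K ^ d * gbar] ([V_HK_le]).

The mixed derivatives are only assumed to exist and to be bounded, and might
not be measurable.  All integrals are therefore compared through
[le_ge0_integralZ], which works on the simple functions below a nonnegative
function. *)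

(** * Comparison of integrals over the cube *)

(** The integral of a nonnegative function is the supremum of the integrals of
the simple functions below it, and scaling by [k^-1] sends a simple function
below [f1] to one below [f2]; so [f1] and [f2] may be arbitrary. *)
Lemma le_ge0_integralZ {d : measure_display} {T : measurableType d}
    {R : realType} (mu : {measure set T -> \bar R}) (D1 D2 : set T)
    (f1 f2 : T -> \bar R) (k : R) :
  D1 `<=` D2 -> 0 < k ->
  (forall x, D1 x -> 0 <= f1 x)%E -> (forall x, D2 x -> 0 <= f2 x)%E ->
  (forall x, D1 x -> f1 x <= k%:E * f2 x)%E ->
  (\int[mu]_(x in D1) f1 x <= k%:E * \int[mu]_(x in D2) f2 x)%E.
Proof.
move=> D12 k0 f10 f20 f12.
have g20 x : (0 <= (f2 \_ D2) x)%E.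
  by rewrite patchE; case: ifPn => // /set_mem/f20.
rewrite [leLHS]integral_mkcond [X in (_ * X)%E]integral_mkcond.
rewrite !ge0_integralTE//; last first.
  by move=> x; rewrite patchE; case: ifPn => // /set_mem/f10.
apply: ge_ereal_sup => _ /= [h hf <-].
rewrite -lee_pdivrMl//.
have ki : 0 <= k^-1 by rewrite invr_ge0 ltW.
rewrite -sintegralrM.
apply: ereal_sup_ubound; exists (scale_nnsfun h ki) => //= x.
rewrite EFinM lee_pdivrMl//.
apply: (le_trans (hf x)); rewrite patchE; case: ifPn => [/set_mem D1x|_].
  by rewrite patchE (mem_set (D12 _ D1x)); exact: f12.
by rewrite mule_ge0// lee_fin ltW.
Qed.

Section CubeIntegral.
Context {R : realType}.

Lemma cube_col_mx d (t : R) (w : 'cV[R]_d) :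
  `[0, 1]%classic t -> cube d w -> cube d.+1 (col_mx (t%:M : 'cV[R]_1) w).
Proof.
move=> /=; rewrite in_itv/= => t01 cw i.
case: (fintype.splitP (i : 'I_(1 + d))) => [j ij|j ij].
  have -> : i = lshift d j by apply: val_inj.
  by rewrite (@col_mxEu _ 1 d) (ord1 j) mxE eqxx mulr1n.
have -> : i = rshift 1 j by apply: val_inj.
by rewrite (@col_mxEd _ 1 d).
Qed.

Lemma cube_face1 d (i : 'I_d.+1) (w : 'cV[R]_d) :
  cube d w -> cube d.+1 (face1 i w).
Proof.
move=> cw j; rewrite mxE; case: unliftP => [k _|_]; first exact: cw.
by rewrite ler01 lexx.
Qed.

Lemma int_cube_ge0 d (f : 'cV[R]_d -> \bar R) :
  (forall z, cube d z -> 0 <= f z)%E -> (0 <= int_cube f)%E.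
Proof.
elim: d f => [|d IH] f f0 /=; first by apply: f0 => -[].
by apply: integral_ge0 => t t01; apply: IH => w cw; exact/f0/cube_col_mx.
Qed.

Lemma int_cubeS d (f : 'cV[R]_d.+1 -> \bar R) : int_cube f =
  (\int[lebesgue_measure]_(t in `[0%R, 1%R])
     int_cube (fun w : 'cV[R]_d => f (col_mx (t%:M : 'cV[R]_1) w)))%E.
Proof. by []. Qed.

Lemma le_int_cubeZ d (f1 f2 : 'cV[R]_d -> \bar R) (k : R) : 0 < k ->
  (forall z, cube d z -> 0 <= f1 z)%E -> (forall z, cube d z -> 0 <= f2 z)%E ->
  (forall z, cube d z -> f1 z <= k%:E * f2 z)%E ->
  (int_cube f1 <= k%:E * int_cube f2)%E.
Proof.
move=> k0; elim: d f1 f2 => [|d IH] f1 f2 f10 f20 f12 /=.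
  by apply: f12 => -[].
apply: le_ge0_integralZ => // t t01.
- by apply: int_cube_ge0 => w cw; exact/f10/cube_col_mx.
- by apply: int_cube_ge0 => w cw; exact/f20/cube_col_mx.
- by apply: IH => w cw; [exact/f10/cube_col_mx|exact/f20/cube_col_mx
    |exact/f12/cube_col_mx].
Qed.

(** For positive [phi] this says that [ln phi] is [K]-Lipschitz in each
coordinate; stated multiplicatively it also makes sense where [phi]
vanishes. *)
Definition log_lipschitz (K : R) d (phi : 'cV[R]_d -> R) :=
  forall (i : 'I_d) z z', cube d z -> cube d z' ->
    (forall j, j != i -> z j 0 = z' j 0) ->
    phi z <= expR (K * `|z i 0 - z' i 0|) * phi z'.

Lemma col_mx0E d (t : R) (w : 'cV[R]_d) :
  (col_mx (t%:M : 'cV[R]_1) w : 'cV[R]_d.+1) ord0 0 = t.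
Proof.
have -> : (ord0 : 'I_d.+1) = lshift d (ord0 : 'I_1) by apply: val_inj.
by rewrite (@col_mxEu _ 1 d) mxE eqxx mulr1n.
Qed.

Lemma col_mx_liftE d (t : R) (w : 'cV[R]_d) (j : 'I_d) :
  (col_mx (t%:M : 'cV[R]_1) w : 'cV[R]_d.+1) (lift ord0 j) 0 = w j 0.
Proof.
have -> : lift ord0 j = rshift 1 j by apply: val_inj.
by rewrite (@col_mxEd _ 1 d).
Qed.

Lemma face1_0E d (w : 'cV[R]_d) :
  face1 ord0 w = col_mx ((1 : R)%:M : 'cV[R]_1) w :> 'cV[R]_d.+1.
Proof.
apply/colP => j; rewrite mxE; case: unliftP => [k ->|->].
  by rewrite col_mx_liftE.
by rewrite col_mx0E.
Qed.

Lemma face1_liftE d (i : 'I_d.+1) (w : 'cV[R]_d) j :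
  face1 i w (lift i j) 0 = w j 0.
Proof. by rewrite mxE liftK. Qed.

Lemma face1_lift_col_mx d (i : 'I_d.+1) (t : R) (w : 'cV[R]_d) :
  face1 (lift ord0 i) (col_mx (t%:M : 'cV[R]_1) w)
  = col_mx (t%:M : 'cV[R]_1) (face1 i w) :> 'cV[R]_d.+2.
Proof.
apply/colP => j; case: (unliftP ord0 j) => [k ->|->]; last first.
  have -> : ord0 = lift (lift ord0 i) ord0 :> 'I_d.+2 by apply: val_inj.
  rewrite face1_liftE col_mx0E.
  have -> : lift (lift ord0 i) ord0 = ord0 :> 'I_d.+2 by apply: val_inj.
  by rewrite col_mx0E.
rewrite col_mx_liftE; case: (unliftP i k) => [l ->|->].
  have -> : lift ord0 (lift i l) = lift (lift ord0 i) (lift ord0 l).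
    by apply: val_inj; rewrite /= /bump !leq0n !add1n ltnS addnS.
  by rewrite !face1_liftE col_mx_liftE.
by rewrite !mxE !unlift_none.
Qed.

Lemma log_lipschitz_col_mx (K : R) d (phi : 'cV[R]_d.+1 -> R) (t : R) :
  `[0, 1]%classic t -> log_lipschitz K phi ->
  log_lipschitz K (fun w : 'cV[R]_d => phi (col_mx (t%:M : 'cV[R]_1) w)).
Proof.
move=> t01 phiK i z z' cz cz' zz'.
rewrite -(col_mx_liftE t z) -(col_mx_liftE t z').
apply: phiK; try exact: cube_col_mx.
move=> j; case: (unliftP ord0 j) => [k -> ki|-> _]; last by rewrite !col_mx0E.
by rewrite !col_mx_liftE zz'//; apply: contraNneq ki => ->.
Qed.

Lemma log_lipschitz_face1 (K : R) d (phi : 'cV[R]_d.+1 -> R) i :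
  log_lipschitz K phi -> log_lipschitz K (fun w => phi (face1 i w)).
Proof.
move=> phiK j z z' cz cz' zz'.
rewrite -(face1_liftE i z) -(face1_liftE i z').
apply: phiK; try exact: cube_face1.
move=> k; rewrite !mxE; case: unliftP => [l -> lj|//].
by rewrite zz'//; apply: contraNneq lj => ->.
Qed.

(** Within distance [K^-1] of the face, [phi] is at least [expR (-1)] times its
value at the projection to the face; the slab of these points has thickness
[K^-1], which gives the factor [expR 1 * K]. *)
Lemma le_int_cube_face1_0 d (K : R) (phi : 'cV[R]_d.+1 -> R) :
  1 <= K -> (forall z, cube d.+1 z -> 0 <= phi z) -> log_lipschitz K phi ->
  (int_cube (fun w => (phi (face1 ord0 w))%:E)
   <= (expR 1 * K)%:E * int_cube (fun z => (phi z)%:E))%E.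
Proof.
move=> K1 phi0 phiK; have K0 : 0 < K by exact: lt_le_trans ltr01 K1.
set I := (X in (X <= _)%E).
have Ki1 : K^-1 <= 1 by rewrite invf_le1.
have Ki0 : 0 < K^-1 by rewrite invr_gt0.
have I0 : (0 <= I)%E.
  by apply: int_cube_ge0 => w cw; rewrite lee_fin phi0//; exact: cube_face1.
have sub : `[1 - K^-1, 1] `<=` `[0, 1 : R].
  by move=> t /=; rewrite !in_itv/= => /andP[t1 ->]; rewrite andbT; lra.
(* [I] as [K] times the integral of the constant [I] over the slab. *)
have -> : I = (K%:E *
    \int[lebesgue_measure]_(t in `[(1 - K^-1)%R, 1%R]) cst I t)%E.
  rewrite integral_cst//= lebesgue_measure_itv/= lte_fin ifT; last by lra.
  rewrite -EFinB muleCA -EFinM.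
  have -> : K * (1 - (1 - K^-1)) = 1 by field; rewrite gt_eqF.
  by rewrite mule1.
rewrite [expR 1 * K]mulrC EFinM -muleA lee_pmul2l//.
apply: le_ge0_integralZ => //.
  move=> t t01; apply: int_cube_ge0 => w cw.
  by rewrite lee_fin phi0//; exact: cube_col_mx.
move=> t tK; have t01 := sub _ tK; rewrite /cst.
apply: le_int_cubeZ => //.
- by move=> w cw; rewrite lee_fin phi0//; exact: cube_face1.
- by move=> w cw; rewrite lee_fin phi0//; exact: cube_col_mx.
move=> w cw; rewrite -EFinM lee_fin.
have cf : cube d.+1 (face1 ord0 w) by exact: cube_face1.
have ct := cube_col_mx t01 cw.
apply: (le_trans (phiK ord0 _ _ cf ct _)).
  move=> j; case: (unliftP ord0 j) => [k -> _|->]; last by rewrite eqxx.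
  by rewrite face1_liftE col_mx_liftE.
rewrite ler_wpM2r ?phi0// ler_expR face1_0E !col_mx0E.
move: tK t01; rewrite /= !in_itv/= => /andP[tK _] /andP[_ t1].
rewrite ger0_norm ?subr_ge0//.
by rewrite -[leRHS](divff (lt0r_neq0 K0)) ler_pM2l//; lra.
Qed.

(** In the iterated integral the coordinate [i] is integrated at depth [i]:
peeling off the outer integrals, which are the same on both sides, reduces to
the first coordinate. *)
Lemma le_int_cube_face1 d (i : 'I_d.+1) (K : R) (phi : 'cV[R]_d.+1 -> R) :
  1 <= K -> (forall z, cube d.+1 z -> 0 <= phi z) -> log_lipschitz K phi ->
  (int_cube (fun w => (phi (face1 i w))%:E)
   <= (expR 1 * K)%:E * int_cube (fun z => (phi z)%:E))%E.
Proof.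
move=> K1; have K0 : 0 < K by exact: lt_le_trans ltr01 K1.
have eK0 : 0 < expR 1 * K by rewrite mulr_gt0 ?expR_gt0.
elim: d i phi => [|d IH] i phi phi0 phiK.
  all: case: (unliftP ord0 i) => [i' ->|->].
- by case: i'.
- exact: le_int_cube_face1_0.
- rewrite !int_cubeS; apply: le_ge0_integralZ => // t t01.
  + apply: int_cube_ge0 => w cw; rewrite lee_fin phi0//.
    exact/cube_face1/cube_col_mx.
  + apply: int_cube_ge0 => w cw; rewrite lee_fin phi0//; exact/cube_col_mx.
  + under [X in (int_cube X <= _)%E]funext do rewrite face1_lift_col_mx.
    apply: (IH i' (fun w => phi (col_mx t%:M w))).
      by move=> z cz; exact/phi0/cube_col_mx.
    exact: log_lipschitz_col_mx.
- exact: le_int_cube_face1_0.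
Qed.

End CubeIntegral.

(** * A bound of the Hardy-Krause variation *)

Section HardyKrause.
Context {R : realType}.

Definition increasing d (s : seq 'I_d) := sorted ltn (map val s).

Lemma increasing_enum d (u : {set 'I_d}) : increasing (enum u).
Proof.
rewrite /increasing sorted_map /enum_mem -enumT.
apply: sorted_filter; first by move=> x y z /=; exact: ltn_trans.
by rewrite -sorted_map val_enum_ord iota_ltn_sorted.
Qed.

Lemma increasing_lift d (i : 'I_d.+1) (s : seq 'I_d) :
  increasing s -> increasing (map (lift i) s).
Proof.
rewrite /increasing -map_comp !sorted_map; apply: sub_sorted => x y /= xy.
by rewrite /bump; case: (leqP i x); case: (leqP i y); lia.
Qed.

Lemma pderivs_face1 d (phi : 'cV[R]_d.+1 -> R^o) (i : 'I_d.+1) (s : seq 'I_d) w :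
  pderivs s (fun w => phi (face1 i w)) w
  = pderivs (map (lift i) s) phi (face1 i w).
Proof.
elim: s w => [//|j s IH] w /=; rewrite /pderiv /incr_cube face1_liftE.
suff -> : diff_quot (pderivs s (fun w => phi (face1 i w))) j w
    = diff_quot (pderivs (map (lift i) s) phi) (lift i j) (face1 i w) by [].
apply/funext => t; rewrite /diff_quot !IH; congr (_ *: (pderivs _ _ _ - _)).
apply/colP => k; rewrite !mxE; case: unliftP => [l ->|->].
  by rewrite !mxE (inj_eq lift_inj).
by rewrite (negbTE (neq_lift _ _)) mulr0 addr0.
Qed.

(** The constant of [V_HK_le]: the cube contributes [B], and each of its [d]
faces contributes the constant of dimension [d - 1], times the factor of
[le_int_cube_face1]. *)
Fixpoint hk_cst (B : R) d :=
  if d is d'.+1 then B + d%:R * (expR 1 * hk_cst B d') else 0.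

Lemma hk_cst_ge0 (B : R) d : 0 <= B -> 0 <= hk_cst B d.
Proof.
by move=> B0; elim: d => //= d IH; rewrite addr_ge0// !mulr_ge0// expR_ge0.
Qed.

Lemma V_HKS d (phi : 'cV[R]_d.+1 -> R) : V_HK phi =
  (int_cube (fun z => `|mixed_deriv [set: 'I_d.+1] (phi : _ -> R^o) z|%:E)
   + \sum_(i < d.+1) V_HK (fun w => phi (face1 i w)))%E.
Proof. by []. Qed.

Lemma V_HK_ge0 d (phi : 'cV[R]_d -> R) : (0 <= V_HK phi)%E.
Proof.
elim: d phi => [//|d IH] phi; rewrite V_HKS adde_ge0//; last exact: sume_ge0.
by apply: int_cube_ge0 => z _; rewrite lee_fin.
Qed.

(** Both hypotheses on [phi] pass to the faces, so the induction applies to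
them.  In dimension [d.+1] a face yields [K ^ d] for the derivatives in its [d]
coordinates and one more [K] from comparing the integral over the face with the
one over the cube; this is the same power [K ^ d.+1] as for the derivative in
all coordinates. *)
Lemma V_HK_le d (B K : R) (phi : 'cV[R]_d -> R) :
  0 < B -> 1 <= K -> (forall z, cube d z -> 0 <= phi z) ->
  log_lipschitz K phi ->
  (forall s, increasing s -> forall z, cube d z ->
     `|pderivs s (phi : _ -> R^o) z| <= B * K ^+ size s * phi z) ->
  (V_HK phi <= (hk_cst B d * K ^+ d)%:E * int_cube (fun z => (phi z)%:E))%E.
Proof.
move=> B0 K1; have K0 : 0 < K by exact: lt_le_trans ltr01 K1.
elim: d phi => [|d IH] phi phi0 phiK phiB; first by rewrite mul0r mul0e.
set I := int_cube _.
have I0 : (0 <= I)%E by apply: int_cube_ge0 => z cz; rewrite lee_fin phi0.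
have -> : hk_cst B d.+1 * K ^+ d.+1 = B * K ^+ d.+1 +
    \sum_(i < d.+1) (hk_cst B d * K ^+ d) * (expR 1 * K).
  by rewrite sumr_const card_ord -mulr_natl /= exprS; ring.
rewrite EFinD ge0_muleDl; last 2 first.
- by rewrite lee_fin mulr_ge0 ?exprn_ge0 ?ltW.
- rewrite lee_fin sumr_ge0// => i _.
  by rewrite !mulr_ge0 ?exprn_ge0 ?expR_ge0 ?hk_cst_ge0 ?ltW.
rewrite V_HKS; apply: leeD.
  apply: le_int_cubeZ => //.
    by rewrite mulr_gt0 ?exprn_gt0.
  move=> z cz; rewrite -EFinM lee_fin.
  have := phiB _ (increasing_enum [set: 'I_d.+1]) z cz.
  by rewrite -cardE cardsT card_ord.
rewrite -sumEFin ge0_sume_distrl; last first.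
  move=> i _; rewrite lee_fin.
  by rewrite !mulr_ge0 ?exprn_ge0 ?expR_ge0 ?hk_cst_ge0 ?ltW.
apply: lee_sum => i _.
apply: (@le_trans _ _ ((hk_cst B d * K ^+ d)%:E *
    int_cube (fun w => (phi (face1 i w))%:E))%E).
  apply: IH.
  - by move=> w cw; exact/phi0/cube_face1.
  - exact: log_lipschitz_face1.
  move=> s s_incr w cw; rewrite pderivs_face1.
  have := phiB _ (increasing_lift i s_incr) _ (cube_face1 i cw).
  by rewrite size_map.
rewrite [X in (_ <= X * _)%E]EFinM -muleA lee_wpmul2l//.
  by rewrite lee_fin mulr_ge0 ?exprn_ge0 ?hk_cst_ge0 ?ltW.
exact: le_int_cube_face1.
Qed.

End HardyKrause.

(** * Calculus of the one-sided partial derivatives *)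

Section OneSidedDerivatives.
Context {R : realType} {d : nat}.
Implicit Types (f g psi : 'cV[R]_d -> R^o) (j : 'I_d) (z : 'cV[R]_d).

#[local] Instance incr_cube_filter j z : Filter (incr_cube j z).
Proof. exact: within_filter. Qed.

(** Limits of difference quotients are unique: from any point of the cube one
can move inwards along each axis. *)
Lemma incr_cube_proper j z : cube d z -> ProperFilter (incr_cube j z).
Proof.
move=> /(_ j) /andP[z0 z1]; apply: Build_ProperFilter_ex => P.
rewrite /incr_cube /within /= => -[e /= e0 He].
have [zl|zl] := leP (z j 0) (1 / 2).
  exists (Num.min (e / 2) (1 / 2)); apply: He => /=.
  - rewrite sub0r normrN gtr0_norm ?lt_min; last lra.
    by rewrite gt_min; apply/orP; left; lra.
  - by apply: lt0r_neq0; rewrite lt_min; lra.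
  - by have [] := lerP (e / 2) (1 / 2); lra.
exists (- Num.min (e / 2) (1 / 2)); apply: He => /=.
- rewrite sub0r opprK gtr0_norm ?lt_min; last lra.
  by rewrite gt_min; apply/orP; left; lra.
- by rewrite oppr_eq0; apply: lt0r_neq0; rewrite lt_min; lra.
- by have [] := lerP (e / 2) (1 / 2); lra.
Qed.

Definition has_pderiv {V : normedModType R} (f : 'cV[R]_d -> V) j z (l : V) :=
  diff_quot f j z @ incr_cube j z --> l.

Lemma pderivableP {V : normedModType R} (f : 'cV[R]_d -> V) j z :
  pderivable f j z -> has_pderiv f j z (pderiv j f z).
Proof. by []. Qed.

Lemma has_pderiv_pderivable {V : normedModType R} (f : 'cV[R]_d -> V) j z l :
  has_pderiv f j z l -> pderivable f j z.
Proof. by move=> fl; apply/cvg_ex; exists l. Qed.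

Lemma has_pderivE {V : normedModType R} (f : 'cV[R]_d -> V) j z l :
  cube d z -> has_pderiv f j z l -> pderiv j f z = l.
Proof.
move=> cz fl; have F := incr_cube_proper j cz.
exact: (cvg_lim (@norm_hausdorff _ _)).
Qed.

Lemma incr_cube_in j z : cube d z ->
  \forall t \near incr_cube j z, cube d (z + t *: delta_mx j 0).
Proof.
move=> cz; rewrite /incr_cube near_withinE; near=> t => /= t01 i.
rewrite !mxE eqxx andbT; have [->|ij] := eqVneq i j; first by rewrite mulr1.
by rewrite mulr0 addr0.
Unshelve. all: by end_near. Qed.

Lemma incr_cube_neq0 j z : \forall t \near incr_cube j z, t != 0.
Proof.
rewrite /incr_cube near_withinE; near=> t => _.
by near: t; exact: nbhs_dnbhs_neq.
Unshelve. all: by end_near. Qed.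

Lemma incr_cube_id j z : t @[t --> incr_cube j z] --> (0 : R).
Proof.
by move=> A A0; apply: cvg_within; exact: nbhs_dnbhs.
Qed.

Lemma eq_has_pderiv {V : normedModType R} (f g : 'cV[R]_d -> V) j z l :
  {in cube d, f =1 g} -> cube d z -> has_pderiv f j z l -> has_pderiv g j z l.
Proof.
move=> fg cz; apply: cvg_trans; apply: near_eq_cvg.
near=> t; rewrite /diff_quot !fg ?inE//.
by near: t; exact: incr_cube_in.
Unshelve. all: by end_near. Qed.

Lemma eq_pderivs f g s : {in cube d, f =1 g} ->
  {in cube d, pderivs s f =1 pderivs s g}.
Proof.
move=> fg; elim: s => [//|j s IH] z /[!inE] cz /=; rewrite /pderiv.
congr (lim _); apply/seteqP; split; apply: near_eq_cvg.
all: near=> t; rewrite /diff_quot !IH ?inE//.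
all: by near: t; exact: incr_cube_in.
Unshelve. all: by end_near. Qed.

Lemma has_pderiv_cst (a : R) j z : has_pderiv (fun=> a : R^o) j z 0.
Proof.
rewrite /has_pderiv /diff_quot; under eq_fun do rewrite subrr scaler0.
exact: cvg_cst.
Qed.

Lemma has_pderivD f g j z l m : has_pderiv f j z l -> has_pderiv g j z m ->
  has_pderiv (fun x => f x + g x : R^o) j z (l + m).
Proof.
move=> fl gm; rewrite /has_pderiv; suff -> : diff_quot (fun x => f x + g x : R^o) j z
    = diff_quot f j z \+ diff_quot g j z by exact: cvgD.
by apply/funext => t; rewrite /diff_quot /= -scalerDr; congr (_ *: _); ring.
Qed.

Lemma has_pderiv_cvg f j z l : has_pderiv f j z l ->
  f (z + t *: delta_mx j 0) @[t --> incr_cube j z] --> f z.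
Proof.
move=> fl.
have : f z + t * diff_quot f j z t @[t --> incr_cube j z] --> f z + 0 * l.
  by apply: cvgD; [exact: cvg_cst|apply: cvgM => //; exact: incr_cube_id].
rewrite mul0r addr0; apply: cvg_trans; apply: near_eq_cvg; near=> t.
rewrite /diff_quot /GRing.scale/= mulVKf ?subrKC//.
by near: t; exact: incr_cube_neq0.
Unshelve. all: by end_near. Qed.

Lemma has_pderivM f g j z l m : has_pderiv f j z l -> has_pderiv g j z m ->
  has_pderiv (fun x => f x * g x : R^o) j z (l * g z + f z * m).
Proof.
move=> fl gm; rewrite /has_pderiv.
have -> : diff_quot (fun x => f x * g x : R^o) j z = fun t =>
    diff_quot f j z t * g (z + t *: delta_mx j 0) + f z * diff_quot g j z t.
  by apply/funext => t; rewrite /diff_quot /GRing.scale/=; ring.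
apply: cvgD; apply: cvgM => //; first exact: has_pderiv_cvg gm.
exact: cvg_cst.
Qed.

(** [expR x - 1 = x * expR_slope x] with [expR_slope] continuous at 0: this
form of the chain rule also covers increments [t] with
[psi (z + t e_j) = psi z]. *)
Let expR_slope (x : R) : R := if x == 0 then 1 else (expR x - 1) / x.

Let expR_slopeE x : expR x - 1 = x * expR_slope x.
Proof.
rewrite /expR_slope; case: eqVneq => [->|x0]; last by rewrite mulrC divfK.
by rewrite expR0 subrr mul0r.
Qed.

Let expR_slope_cvg : expR_slope x @[x --> (0 : R)] --> (1 : R).
Proof.
have e0 : expR_slope 0 = 1 by rewrite /expR_slope eqxx.
suff : {for (0 : R), continuous expR_slope}.
  by move=> /= h; rewrite -[X in _ --> X]e0; exact: h.
apply/continuous_withinNx; rewrite e0.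
have : (h^-1 *: ((expR (h *: 1 + 0) : R^o) - 1)) @[h --> (0 : R)^'] --> (1 : R).
  have [dl de] := @is_derive_expR R 0.
  have {}dl := dl : _ --> _.
  by rewrite -/(derive _ _ _) de expR0 in dl.
apply: cvg_trans; apply: near_eq_cvg; near=> h.
have h0 : h != 0 by near: h; exact: nbhs_dnbhs_neq.
rewrite /expR_slope (negbTE h0) /GRing.scale/= mulr1 addr0.
by rewrite mulrC.
Unshelve. all: by end_near. Qed.

Lemma has_pderiv_expR psi j z l : has_pderiv psi j z l ->
  has_pderiv (fun x => expR (psi x) : R^o) j z (l * expR (psi z)).
Proof.
move=> pl; pose D t := psi (z + t *: delta_mx j 0) - psi z.
have D0 : D t @[t --> incr_cube j z] --> (0 : R).
  rewrite -(subrr (psi z)); apply: cvgB; last exact: cvg_cst.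
  exact: has_pderiv_cvg pl.
rewrite /has_pderiv.
have -> : diff_quot (fun x => expR (psi x) : R^o) j z = fun t =>
    diff_quot psi j z t * expR_slope (D t) * expR (psi z).
  apply/funext => t; rewrite /diff_quot /GRing.scale/= -/(D t).
  rewrite -mulrA -mulrA; congr (_ * _); rewrite mulrA -expR_slopeE mulrBl.
  by rewrite mul1r -expRD /D subrK.
rewrite -[in X in _ --> X](mulr1 l); apply: cvgM; last exact: cvg_cst.
apply: cvgM => //; exact: (cvg_comp _ _ D0 expR_slope_cvg).
Qed.

End OneSidedDerivatives.

(** * Bounds of mixed derivatives *)

Section BoundedMixedDerivatives.
Context {R : realType} {d : nat}.
Implicit Types (f g psi : 'cV[R]_d -> R^o) (j : 'I_d) (z : 'cV[R]_d).
Implicit Types (r : seq 'I_d) (A B K : R).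

(** [r] lists the variables in the order of differentiation, which is the
reverse of the order in [pderivs]; the recursion decides for each variable in
turn whether to differentiate, so that all sublists of [r] are controlled by
the same bound.  This is what makes the predicate stable under products: in
the Leibniz rule the derivatives are split between the two factors. *)
Fixpoint pderivs_bounded r f B : Prop :=
  if r is j :: r' then
    [/\ pderivs_bounded r' f B, forall z, cube d z -> pderivable f j z
      & pderivs_bounded r' (pderiv j f) B]
  else forall z, cube d z -> `|f z| <= B.

Lemma eq_pderivs_bounded r f g B : {in cube d, f =1 g} ->
  pderivs_bounded r f B -> pderivs_bounded r g B.
Proof.
elim: r f g => [|j r IH] f g fg /=.
  by move=> fB z cz; rewrite -fg ?inE//; exact: fB.
move=> [fB df dfB]; split; first exact: IH fB.
- move=> z cz; apply: has_pderiv_pderivable.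
  exact/(eq_has_pderiv fg cz)/pderivableP/df.
- by apply: IH dfB; exact: (@eq_pderivs _ _ f g [:: j]).
Qed.

Lemma le_pderivs_bounded r f A B : A <= B ->
  pderivs_bounded r f A -> pderivs_bounded r f B.
Proof.
move=> AB; elim: r f => [|j r IH] f /=.
  by move=> fA z cz; exact: le_trans (fA z cz) AB.
by move=> [fA df dfA]; split => //; exact: IH.
Qed.

Lemma pderivs_bounded_ge0 r f B : pderivs_bounded r f B -> 0 <= B.
Proof.
elim: r f => [|i r IH] f; last by move=> [/IH].
move=> /(_ 0) f0; apply: le_trans (f0 _) => // i.
by rewrite mxE lexx ler01.
Qed.

Lemma pderivs_bounded_has_pderiv j r f g B :
  (forall z, cube d z -> has_pderiv f j z (g z)) ->
  pderivs_bounded r f B -> pderivs_bounded r g B ->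
  pderivs_bounded (j :: r) f B.
Proof.
move=> fg fB gB; split => //.
  by move=> z cz; exact: has_pderiv_pderivable (fg z cz).
apply: eq_pderivs_bounded gB => z /[!inE] cz.
by rewrite (has_pderivE cz (fg z cz)).
Qed.

Lemma pderivs_bounded_cst r (a B : R) : `|a| <= B ->
  pderivs_bounded r (fun=> a) B.
Proof.
elim: r a => [|j r IH] a aB /=; first by move=> z _.
apply: (pderivs_bounded_has_pderiv (g := fun=> 0)).
- by move=> z _; exact: has_pderiv_cst.
- exact: IH.
- by apply: IH; rewrite normr0; exact: le_trans aB.
Qed.

Lemma pderivs_boundedD r f g A B :
  pderivs_bounded r f A -> pderivs_bounded r g B ->
  pderivs_bounded r (fun z => f z + g z : R^o) (A + B).
Proof.
elim: r f g => [|j r IH] f g /=.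
  move=> fA gB z cz; apply: (le_trans (ler_normD _ _)).
  by apply: lerD; [exact: fA|exact: gB].
move=> [fA df dfA] [gB dg dgB].
apply: (pderivs_bounded_has_pderiv
  (g := fun z => pderiv j f z + pderiv j g z)); try exact: IH.
by move=> z cz; apply: has_pderivD; apply: pderivableP; [exact: df|exact: dg].
Qed.

(** [2 ^+ size r] is the number of terms of the iterated Leibniz rule. *)
Lemma pderivs_boundedM r f g A B :
  pderivs_bounded r f A -> pderivs_bounded r g B ->
  pderivs_bounded r (fun z => f z * g z : R^o) (2 ^+ size r * (A * B)).
Proof.
elim: r f g => [|j r IH] f g.
  by move=> fA gB z cz; rewrite mul1r normrM ler_pM//; [exact: fA|exact: gB].
move=> [fA df dfA] [gB dg dgB].
have -> : 2 ^+ size (j :: r) * (A * B)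
    = 2 ^+ size r * (A * B) + 2 ^+ size r * (A * B) by rewrite /= exprS; ring.
apply: (pderivs_bounded_has_pderiv
  (g := fun z => pderiv j f z * g z + f z * pderiv j g z)).
- by move=> z cz; apply: has_pderivM; apply: pderivableP; [exact: df|exact: dg].
- apply: le_pderivs_bounded (IH _ _ fA gB); rewrite lerDl.
  rewrite mulr_ge0// mulr_ge0// ?(pderivs_bounded_ge0 fA)//.
  exact: pderivs_bounded_ge0 gB.
- by apply: pderivs_boundedD; exact: IH.
Qed.

Lemma pderivs_bounded_sum (I : Type) (s : seq I) r (F : I -> 'cV[R]_d -> R^o)
    (B : I -> R) : (forall i, pderivs_bounded r (F i) (B i)) ->
  pderivs_bounded r (fun z => \sum_(i <- s) F i z : R^o) (\sum_(i <- s) B i).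
Proof.
move=> FB; elim: s => [|i s IH].
  rewrite big_nil; apply: (@eq_pderivs_bounded _ (fun=> 0)).
    by move=> z _; rewrite big_nil.
  by apply: pderivs_bounded_cst; rewrite normr0.
rewrite big_cons; apply: eq_pderivs_bounded (pderivs_boundedD (FB i) IH).
by move=> z _; rewrite big_cons.
Qed.

Lemma pderivs_boundedZ r f (a : R) B : pderivs_bounded r f B ->
  pderivs_bounded r (fun z => a * f z : R^o) (`|a| * B).
Proof.
elim: r f => [|j r IH] f /=.
  by move=> fB z cz; rewrite normrM ler_wpM2l ?fB.
move=> [fB df dfB].
apply: (pderivs_bounded_has_pderiv (g := fun z => a * pderiv j f z)); try exact: IH.
move=> z cz; have := has_pderivM (has_pderiv_cst a j z) (pderivableP (df z cz)).
by rewrite mul0r add0r.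
Qed.

(** Differentiating [f * expR psi] replaces [f] by
[f' = pderiv j f + f * pderiv j psi], again with bounded mixed derivatives; the
exponential is never expanded, so the bound stays relative to [expR psi].  The
bound of [f'] is that of [f] times [(1 + 2 ^+ n) * K]: the derivative of [psi]
costs the factor [K]. *)
Lemma pderivs_mul_expR_le n r f psi A K : (size r <= n)%N -> 0 <= A -> 1 <= K ->
  pderivs_bounded r f A -> pderivs_bounded r psi K ->
  forall z, cube d z ->
    `|pderivs (rev r) (fun x => f x * expR (psi x) : R^o) z|
    <= (1 + 2 ^+ n) ^+ size r * A * K ^+ size r * expR (psi z).
Proof.
move=> + + K1; have K0 : 0 <= K by exact: le_trans K1.
elim: r f A => [|j r IH] f A rn A0 fA pK z cz.
  rewrite /= !expr0 mul1r mulr1 normrM (ger0_norm (expR_ge0 _)).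
  by rewrite ler_wpM2r ?expR_ge0//; exact: fA.
case: fA => fA df dfA; case: pK => pK dp dpK.
have step : {in cube d, pderiv j (fun x => f x * expR (psi x) : R^o)
   =1 fun x => (pderiv j f x + f x * pderiv j psi x) * expR (psi x) : R^o}.
  move=> x /[!inE] cx.
  have /(has_pderivE cx) -> := has_pderivM (pderivableP (df x cx))
    (has_pderiv_expR (pderivableP (dp x cx))).
  by rewrite mulrDl mulrA.
rewrite rev_cons /pderivs foldr_rcons -/(pderivs _ _).
rewrite (eq_pderivs (rev r) step) ?inE//.
have A'A : A + 2 ^+ size r * (A * K) <= (1 + 2 ^+ n) * A * K.
  have -> : (1 + 2 ^+ n) * A * K = A * K + 2 ^+ n * (A * K) by ring.
  apply: lerD; first by rewrite ler_peMr.
  by rewrite ler_wpM2r ?mulr_ge0// ler_weXn2l ?ler1n// ltnW.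
have A'0 : 0 <= A + 2 ^+ size r * (A * K).
  by rewrite addr_ge0// !mulr_ge0// exprn_ge0.
have -> : (1 + 2 ^+ n) ^+ size (j :: r) * A * K ^+ size (j :: r) * expR (psi z)
   = (1 + 2 ^+ n) ^+ size r * ((1 + 2 ^+ n) * A * K) * K ^+ size r * expR (psi z).
  by rewrite /= !exprS; ring.
apply: le_trans (IH _ _ (ltnW rn) A'0 _ pK z cz) _.
  exact: pderivs_boundedD dfA (pderivs_boundedM fA dpK).
rewrite ler_wpM2r ?expR_ge0// ler_wpM2r ?exprn_ge0//.
by rewrite ler_wpM2l// exprn_ge0// addr_ge0// exprn_ge0.
Qed.

End BoundedMixedDerivatives.

(** * The truncated normal quantile *)

Section TruncatedNormal.
Context {R : realType}.

Local Notation P := (normal_prob (0 : R) 1 : probability _ R).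

Lemma PhiE (x : R) : (Phi x)%:E = P `]-oo, x]%classic.
Proof. by rewrite /Phi fineK// fin_num_measure. Qed.

(** On the interval the density is at least its value at
[sqrt (x ^ 2 + y ^ 2)], which is positive. *)
Lemma normal_prob_itv_gt0 (x y : R) : x < y -> (0 < P `]x, y]%classic)%E.
Proof.
move=> xy; set k := normal_peak 1 * expR (- (x ^+ 2 + y ^+ 2) / 2).
have k0 : 0 < k by rewrite mulr_gt0 ?expR_gt0 ?normal_peak_gt0 ?oner_eq0.
have : (\int[lebesgue_measure]_(z in `]x, y]) cst 1 z <= k^-1%:E * P `]x, y]%classic)%E.
  apply: le_ge0_integralZ => //.
  - by rewrite invr_gt0.
  - by move=> z _; rewrite lee_fin normal_pdf_ge0.
  move=> z /=; rewrite in_itv/= => /andP[xz zy].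
  rewrite -EFinM lee_fin ler_pdivlMl// mulr1 normal_pdfE ?oner_eq0//.
  rewrite ler_wpM2l ?normal_peak_ge0// ler_expR subr0 expr1n.
  by rewrite ler_pM2r ?invr_gt0// lerN2; case: (leP 0 z) => z0; nra.
rewrite integral_cst//= lebesgue_measure_itv/= lte_fin xy mul1e.
rewrite lee_pdivlMl//; apply: lt_le_trans.
by rewrite mule_gt0 ?lte_fin// subr_gt0.
Qed.

Lemma Phi_lt (x y : R) : x < y -> Phi x < Phi y.
Proof.
move=> xy; rewrite -lte_fin !PhiE.
have -> : `]-oo, y]%classic = `]-oo, x] `|` `]x, y].
  apply/seteqP; split => z /=; rewrite !in_itv/=.
    by move=> zy; case: (leP z x) => xz; [left|right].
  by move=> [zx|/andP[]//]; exact: le_trans zx (ltW xy).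
rewrite measureU//; last first.
  rewrite -subset0 => z [/=]; rewrite !in_itv/= => zx /andP[xz _].
  by move: (lt_le_trans xz zx); rewrite ltxx.
apply: lte_spaddre => //; first by rewrite -PhiE.
exact: normal_prob_itv_gt0.
Qed.

Lemma PhiN (x : R) : Phi (- x) = 1 - Phi x.
Proof.
apply: EFin_inj; rewrite EFinB !PhiE -probability_setC// setCitvl.
rewrite /= /normal_prob [RHS]integral_itv_obnd_cbnd; last first.
  apply/measurable_realfun.measurable_EFinP.
  exact: measurable_funS (measurable_normal_pdf 0 1).
rewrite ge0_integration_by_substitutionNy.
- apply: eq_integral => y _ /=.
  by rewrite !normal_pdfE ?oner_eq0// /normal_fun !subr0 sqrrN.
- by apply: continuous_subspaceT; apply: continuous_normal_pdf; exact: oner_neq0.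
- by move=> y _; exact: normal_pdf_ge0.
Qed.

(** By symmetry of the normal law the argument of [Phi_inv] lies between
[Phi (- c)] and [Phi c], and [Phi] is strictly increasing; where [Phi_inv] has
no preimage to return, its default value 0 satisfies the bound as well. *)
Lemma Finv_bound (c y : R) : 0 <= c -> 0 <= y <= 1 -> `|Finv c y| <= c.
Proof.
move=> c0 /andP[y0 y1]; rewrite /Finv /Phi_inv.
set q := (_ + _); case: xgetP => [x _ /= xq|_]; last by rewrite normr0.
have cc : Phi (- c) <= Phi c.
  by move: c0; rewrite le_eqVlt => /predU1P[<-|c0]; [rewrite oppr0|
    apply/ltW/Phi_lt; lra].
rewrite PhiN in cc.
rewrite ler_norml leNgt [X in _ && X]leNgt; apply/andP; split; apply/negP.
  by move=> /Phi_lt; rewrite xq PhiN /q; nra.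
by move=> /Phi_lt; rewrite xq /q; nra.
Qed.

End TruncatedNormal.

(** * Gaussian functions of a map with bounded mixed derivatives *)

Section VectorValued.
Context {R : realType}.

Lemma coord_le_norm2 n (v : 'cV[R]_n) k : `|v k 0| <= norm2 v.
Proof.
rewrite -sqrtr_sqr ler_wsqrtr// (bigD1 k)//= lerDl sumr_ge0// => i _.
exact: sqr_ge0.
Qed.

Lemma norm2_one_coord n (v : 'cV[R]_n) i :
  (forall j, j != i -> v j 0 = 0) -> norm2 v = `|v i 0|.
Proof.
move=> v0; rewrite /norm2 (bigD1 i)//= big1 ?addr0 ?sqrtr_sqr// => j ji.
by rewrite v0// expr0n.
Qed.

Lemma increasing_uniq d (s : seq 'I_d) : increasing s -> uniq s.
Proof.
rewrite /increasing sorted_map; apply: sorted_uniq.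
  by move=> x y z /=; exact: ltn_trans.
by move=> x /=; rewrite ltnn.
Qed.

Lemma size_increasing d (s : seq 'I_d) : increasing s -> (size s <= d)%N.
Proof.
move=> /increasing_uniq/card_uniqP <-; rewrite -[leqRHS]card_ord.
exact: max_card.
Qed.

(** Links the derivatives along increasing lists to the derivatives indexed by
sets. *)
Lemma increasingE d (s : seq 'I_d) :
  increasing s -> s = enum [set j in s]%SET.
Proof.
move=> si; have := increasing_enum [set j in s]%SET; move: si.
rewrite /increasing !sorted_map => si ei.
apply: (irr_sorted_eq _ _ si ei).
- by move=> x y z /=; exact: ltn_trans.
- by move=> x /=; rewrite ltnn.
- by move=> j; rewrite mem_enum inE.
Qed.

Lemma has_pderiv_coord d n (G : 'cV[R]_d -> 'cV[R]_n) j z l k :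
  has_pderiv G j z l -> has_pderiv (fun x => G x k 0 : R^o) j z (l k 0).
Proof.
move=> Gl; rewrite /has_pderiv.
have -> : diff_quot (fun x => G x k 0 : R^o) j z
    = (fun v : 'cV[R]_n => v k 0) \o diff_quot G j z.
  by apply/funext => t; rewrite /diff_quot /= !mxE.
apply: (@cvg_comp _ _ _ (diff_quot G j z) (fun v : 'cV[R]_n => v k 0) _ _ _ Gl).
exact: coord_continuous.
Qed.

(** Generalized over the list [t] of derivatives already taken: each new one is
along a variable smaller than those in [t], so that only derivatives along
increasing lists occur. *)
Lemma pderivs_bounded_coord d n (G : 'cV[R]_d -> 'cV[R]_n) (L : R) r t k :
  (forall s, increasing s -> pderivs_exist s G) ->
  (forall s, increasing s -> forall z, cube d z -> norm2 (pderivs s G z) <= L) ->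
  increasing (rev r ++ t) ->
  pderivs_bounded r (fun z => pderivs t G z k 0 : R^o) L.
Proof.
move=> dG bG; elim: r t => [|j r IH] t /=.
  by move=> ti z cz; apply: le_trans (bG t ti z cz); exact: coord_le_norm2.
rewrite rev_cons cat_rcons => jt_incr.
have t_incr : increasing (rev r ++ t).
  move: jt_incr; rewrite /increasing !map_cat; apply: subseq_sorted.
    exact: ltn_trans.
  by rewrite cat_subseq//; exact: subseq_cons.
have [_ djt] : pderivs_exist (j :: t) G.
  apply: dG; move: jt_incr; rewrite /increasing map_cat; apply: subseq_sorted.
    exact: ltn_trans.
  exact: suffix_subseq.
apply: (pderivs_bounded_has_pderiv (g := fun z => pderivs (j :: t) G z k 0)).
- by move=> z cz; apply: has_pderiv_coord; exact/pderivableP/djt.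
- exact: IH.
- exact: IH.
Qed.

End VectorValued.

Section Gaussian.
Context {R : realType} {d n : nat}.
Variables (M : 'M[R]_n) (G : 'cV[R]_d -> 'cV[R]_n) (L : R).

Definition quad (v : 'cV[R]_n) : R := (v^T *m M *m v) 0 0.

Lemma quadE v : quad v = \sum_l \sum_k M k l * (v k 0 * v l 0).
Proof.
rewrite /quad mxE; apply: eq_bigr => l _; rewrite mxE mulr_suml.
by apply: eq_bigr => k _; rewrite mxE; ring.
Qed.

(** [- quad (a - G x) / 2] without its part [- quad a / 2], which is of second
order in [a] and constant in [x]. *)
Definition exponent (a : 'cV[R]_n) (x : 'cV[R]_d) : R^o :=
  \sum_l \sum_k (M k l / 2) *
    (a k 0 * G x l 0 + a l 0 * G x k 0 + -1 * (G x k 0 * G x l 0)).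

Lemma quad_subE a x : - (1 / 2) * quad (a - G x) = - (1 / 2) * quad a + exponent a x.
Proof.
rewrite !quadE !mulr_sumr -big_split/=; apply: eq_bigr => l _.
rewrite !mulr_sumr -big_split/=; apply: eq_bigr => k _.
by rewrite !mxE; field.
Qed.

(** The two linear terms of [exponent] account for [alpha * L]; the product
[G_k * G_l] accounts for [2 ^+ d * L ^+ 2], by [pderivs_boundedM].  The summand
1 makes the constant at least 1. *)
Definition exponent_cst (alpha : R) : R :=
  1 + \sum_l \sum_k `|M k l| * (alpha * L + 2 ^+ d * L ^+ 2).

Variables (alpha c : R) (a : 'cV[R]_n).
Hypotheses (L0 : 0 <= L) (c1 : 1 <= c) (alpha0 : 0 <= alpha).
Hypothesis a_le : forall k, `|a k 0| <= alpha * c.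
Hypothesis G_bounded : forall s k, increasing s ->
  pderivs_bounded (rev s) (fun x => G x k 0 : R^o) L.
Hypothesis G_lip : forall z z', cube d z -> cube d z' ->
  norm2 (G z - G z') <= L * norm2 (z - z').

Local Notation K := (exponent_cst alpha * c).

Lemma exponent_cst_ge1 : 1 <= exponent_cst alpha.
Proof.
rewrite lerDl !sumr_ge0// => l _; rewrite sumr_ge0// => k _.
by rewrite mulr_ge0// addr_ge0// ?mulr_ge0 ?exprn_ge0.
Qed.

(** The bound is linear in [c], as [exponent] is affine in [a] and only the bound
[alpha * c] of [a] grows with [c]. *)
Lemma exponent_bounded s : increasing s ->
  pderivs_bounded (rev s) (exponent a) K.
Proof.
move=> si; have sd : (size (rev s) <= d)%N by rewrite size_rev size_increasing.
apply: (@le_pderivs_bounded _ _ _ _ (\sum_l \sum_k `|M k l / 2| *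
  (`|a k 0| * L + `|a l 0| * L + `|-1| * (2 ^+ size (rev s) * (L * L))))).
  rewrite mulrDl mul1r -[leLHS]add0r lerD//; first exact: le_trans c1.
  rewrite mulr_suml; apply: ler_sum => l _.
  rewrite mulr_suml; apply: ler_sum => k _.
  rewrite normrM normrN1 mul1r (ger0_norm (_ : 0 <= 2^-1)) ?invr_ge0//.
  rewrite -!mulrA ler_wpM2l//.
  have h1 : `|a k 0| * L <= alpha * c * L by rewrite ler_wpM2r.
  have h2 : `|a l 0| * L <= alpha * c * L by rewrite ler_wpM2r.
  have h3 : 2 ^+ size (rev s) * (L * L) <= 2 ^+ d * L ^+ 2 * c.
    rewrite -[leLHS]mulr1 ler_pM ?mulr_ge0 ?exprn_ge0// -expr2.
    by rewrite ler_wpM2r ?sqr_ge0// ler_weXn2l// ler1n.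
  have h4 : 0 <= 2 ^+ size (rev s) * (L * L) by rewrite !mulr_ge0// exprn_ge0.
  rewrite ler_pdivrMl//; nra.
apply: pderivs_bounded_sum => l; apply: pderivs_bounded_sum => k.
apply: pderivs_boundedZ; apply: pderivs_boundedD.
  by apply: pderivs_boundedD; apply: pderivs_boundedZ; exact: G_bounded.
by apply: pderivs_boundedZ; apply: pderivs_boundedM; exact: G_bounded.
Qed.

Lemma G_coord_le k z : cube d z -> `|G z k 0| <= L.
Proof. by move=> cz; exact: (@G_bounded [::] k isT z cz). Qed.

Lemma exponent_lip (i : 'I_d) z z' : cube d z -> cube d z' ->
  (forall j, j != i -> z j 0 = z' j 0) ->
  exponent a z - exponent a z' <= K * `|z i 0 - z' i 0|.
Proof.
move=> cz cz' zz'; set D := `|_ - _|.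
have D0 : 0 <= D by exact: normr_ge0.
have dG k : `|G z k 0 - G z' k 0| <= L * D.
  have := coord_le_norm2 (G z - G z') k; rewrite !mxE => /le_trans; apply.
  apply: le_trans (G_lip cz cz') _; rewrite (@norm2_one_coord _ _ _ i) ?mxE//.
  by move=> j ji; rewrite !mxE zz'// subrr.
rewrite /exponent -sumrB mulrDl mul1r mulrDl -[leLHS]add0r lerD//.
  by rewrite mulr_ge0// (le_trans _ c1).
rewrite !mulr_suml; apply: ler_sum => l _; rewrite -sumrB.
rewrite !mulr_suml; apply: ler_sum => k _.
rewrite -mulrBr (le_trans (ler_norm _))// normrM normrM.
rewrite (ger0_norm (_ : 0 <= 2^-1)) ?invr_ge0//.
rewrite -!mulrA ler_wpM2l// ler_pdivrMl//.
have -> : a k 0 * G z l 0 + a l 0 * G z k 0 + -1 * (G z k 0 * G z l 0) -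
   (a k 0 * G z' l 0 + a l 0 * G z' k 0 + -1 * (G z' k 0 * G z' l 0))
  = a k 0 * (G z l 0 - G z' l 0) + a l 0 * (G z k 0 - G z' k 0)
    - ((G z k 0 - G z' k 0) * G z l 0 + G z' k 0 * (G z l 0 - G z' l 0)).
  by ring.
have P x y (A B : R) : `|x| <= A -> `|y| <= B -> `|x * y| <= A * B.
  by move=> xA yB; rewrite normrM ler_pM.
apply: le_trans (ler_normB _ _) _.
apply: le_trans (lerD (ler_normD _ _) (ler_normD _ _)) _.
apply: le_trans (lerD (lerD (P _ _ _ _ (a_le k) (dG l)) (P _ _ _ _ (a_le l) (dG k)))
  (lerD (P _ _ _ _ (dG k) (G_coord_le l cz))
        (P _ _ _ _ (G_coord_le k cz') (dG l)))) _.
have h : L ^+ 2 * D <= 2 ^+ d * L ^+ 2 * (c * D).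
  have -> : L ^+ 2 * D = 1 * L ^+ 2 * (1 * D) by ring.
  rewrite ler_pM ?mulr_ge0 ?sqr_ge0// ?ler_wpM2r ?sqr_ge0//.
  by rewrite exprn_ege1// ler1n.
by move: h; rewrite expr2; nra.
Qed.

(** The constant in front of [K ^+ d * int_cube phi] involves [d] only, hence
neither [kappa] nor the value of [quad a]: both sides are proportional to
[phi]. *)
Lemma V_HK_gaussian_le (kappa : R) (phi : 'cV[R]_d -> R) : 0 <= kappa ->
  (forall x, phi x = kappa * expR (- (1 / 2) * quad (a - G x))) ->
  (V_HK phi <= (hk_cst ((1 + 2 ^+ d) ^+ d) d * K ^+ d)%:E
               * int_cube (fun x => (phi x)%:E))%E.
Proof.
move=> kappa0 phiE; set kappa' := kappa * expR (- (1 / 2) * quad a).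
have kappa'0 : 0 <= kappa' by rewrite mulr_ge0// expR_ge0.
have {phiE} -> : phi = fun x => kappa' * expR (exponent a x).
  by apply/funext => x; rewrite phiE quad_subE expRD mulrA.
have K1 : 1 <= K by rewrite mulr_ege1// exponent_cst_ge1.
have d1 : 1 <= 1 + 2 ^+ d :> R by rewrite lerDl exprn_ge0.
apply: V_HK_le => //.
- by move=> z cz; rewrite mulr_ge0// expR_ge0.
- move=> i z z' cz cz' zz'; rewrite mulrCA ler_wpM2l// -expRD ler_expR.
  by rewrite -lerBlDr exponent_lip.
move=> s si z cz; have sd := size_increasing si.
have kB : pderivs_bounded (rev s) (fun=> kappa' : R^o) kappa'.
  by apply: pderivs_bounded_cst; rewrite ger0_norm.
have sd' : (size (rev s) <= d)%N by rewrite size_rev.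
have := pderivs_mul_expR_le sd' kappa'0 K1 kB (exponent_bounded si) cz.
rewrite revK size_rev => /le_trans; apply.
set B := (1 + 2 ^+ d) ^+ d; set Ks := K ^+ size s; set e := expR _.
rewrite (_ : B * Ks * (kappa' * e) = B * kappa' * Ks * e); last by ring.
do 3 (apply: ler_wpM2r; rewrite ?expR_ge0 ?exprn_ge0 ?(le_trans ler01 K1)//).
exact: ler_weXn2l.
Qed.

End Gaussian.

(** * The ratio of variation and mean *)

(** For [y = 0] the hypothesis forces [x = 0], and [0 / 0 = 0]; for [y = +oo] the
quotient is 0 as well. *)
Lemma abse_div_le {R : realType} (x y : \bar R) (C : R) :
  (0 <= x)%E -> (0 <= y)%E -> 0 <= C -> (x <= C%:E * y)%E ->
  (`|x / y| <= C%:E)%E.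
Proof.
move=> x0 y0 C0 xy; rewrite gee0_abs ?mule_ge0 ?inve_ge0//.
move: y y0 xy => [r| |]// r0 xr; last by rewrite invey mule0 lee_fin.
have [r00|rn0] := eqVneq r 0.
  move: xr; rewrite r00 mule0 => x_le0.
  have -> : x = 0%E by apply/eqP; rewrite eq_le x_le0 x0.
  by rewrite mul0e lee_fin.
have r_gt0 : 0 < r by rewrite lt_neqAle eq_sym rn0 -lee_fin.
by rewrite inver (negbTE rn0) lee_pdivrMr.
Qed.

Lemma cube_pt1 {R : realType} (d1 d2 : nat) (le_d : (d2 <= d1)%N) (y : 'cV[R]_d1) :
  cube d1 y -> cube d2 (pt1 le_d y).
Proof. by move=> cy i; rewrite mxE castmxE [X in y _ X]ord1; exact: cy. Qed.

Lemma cube_pt2 {R : realType} (d1 d2 : nat) (le_d : (d2 <= d1)%N) (y : 'cV[R]_d1) :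
  cube d1 y -> cube (d1 - d2) (pt2 le_d y).
Proof. by move=> cy i; rewrite mxE castmxE [X in y _ X]ord1; exact: cy. Qed.

Theorem lemma2 (R : realType) (d1 d2 : nat) (d2_gt0 : (1 <= d2)%N)
    (d21 : (d2 < d1)%N) (Sigma : 'M[R]_(d1 - d2)) (Sigma_pd : posdefmx Sigma)
    (G : R -> 'cV[R]_d2 -> 'cV[R]_(d1 - d2)) (L : R) (L_ge0 : 0 <= L)
    (G_diff : forall h : R, 0 < h -> forall u : {set 'I_d2},
       mixed_deriv_exists u (G h))
    (G_bound : forall h : R, 0 < h -> forall (z : 'cV[R]_d2) (u : {set 'I_d2}),
       cube d2 z -> norm2 (mixed_deriv u (G h) z) <= L)
    (G_lip : forall h : R, 0 < h -> forall z z' : 'cV[R]_d2,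
       cube d2 z -> cube d2 z' ->
       norm2 (G h z - G h z') <= L * norm2 (z - z'))
    (p : R) (p_gt0 : 0 < p) :
  exists Lt : R, 0 <= Lt /\
  exists c0 : R, forall h TOL : R, 0 < h -> 0 < TOL -> c0 <= c_of p TOL ->
    (ereal_sup
       [set `|V_HK (g (ltnW d21) Sigma (G h) (c_of p TOL) y)
              / gbar (ltnW d21) Sigma (G h) (c_of p TOL) y| | y in cube d1]
     <= (Lt ^+ d2 * c_of p TOL ^+ d2)%:E)%E.
Proof.
pose T := sqrtmx Sigma; pose M := invmx Sigma.
pose alpha := L + \sum_i \sum_j `|T i j|.
have T0 i : 0 <= \sum_j `|T i j| by exact: sumr_ge0.
have alpha0 : 0 <= alpha by rewrite addr_ge0// sumr_ge0.
pose B : R := (1 + 2 ^+ d2) ^+ d2.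
pose H := hk_cst B d2; pose C := exponent_cst (d := d2) M L alpha.
have B0 : 0 <= B by rewrite exprn_ge0// addr_ge0// exprn_ge0.
have H0 : 0 <= H by exact: hk_cst_ge0.
have C0 : 0 <= C by rewrite (le_trans ler01)// exponent_cst_ge1.
(* As [1 <= d2], [H <= (1 + H) ^+ d2], so the constant [H] fits into [Lt ^+ d2]. *)
exists ((1 + H) * C); split; first by rewrite mulr_ge0// addr_ge0.
(* For [1 <= c] the parts of the bounds constant in [c] are absorbed into
   multiples of [c]. *)
exists 1 => h TOL h0 _; set c := c_of p TOL => c1.
have c0 : 0 <= c by exact: le_trans c1.
apply: ge_ereal_sup => _ [y cy <-].
have G_bounded s k : increasing s ->
    pderivs_bounded (rev s) (fun x => G h x k 0 : R^o) L.
  move=> si; apply: (@pderivs_bounded_coord _ _ _ (G h) L (rev s) [::]).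
  - by move=> u /increasingE ->; exact: G_diff.
  - by move=> u /increasingE -> z cz; exact: G_bound.
  - by rewrite revK cats0.
pose a := G h (pt1 (ltnW d21) y) + T *m map_mx (Finv c) (pt2 (ltnW d21) y).
have a_le k : `|a k 0| <= alpha * c.
  rewrite mxE mulrDl (le_trans (ler_normD _ _))// lerD//.
    apply: le_trans (G_coord_le G_bounded k (cube_pt1 _ cy)) _.
    by rewrite ler_peMr.
  apply: (@le_trans _ _ ((\sum_j `|T k j|) * c)); last first.
    by rewrite ler_wpM2r// [leRHS](bigD1 k)//= lerDl sumr_ge0.
  rewrite mxE mulr_suml (le_trans (ler_norm_sum _ _ _))//.
  apply: ler_sum => j _; rewrite normrM ler_wpM2l// mxE.
  by apply: Finv_bound => //; exact: cube_pt2.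
have kappa0 : 0 <= (Num.sqrt (\det ((2 * pi) *: Sigma)))^-1.
  by rewrite invr_ge0.
have V_le := V_HK_gaussian_le L_ge0 c1 alpha0 a_le G_bounded (G_lip h h0)
  (phi := g (ltnW d21) Sigma (G h) c y) kappa0 (fun=> erefl).
have HC : H * (C * c) ^+ d2 <= ((1 + H) * C) ^+ d2 * c ^+ d2.
  rewrite !exprMn (mulrA H) !ler_wpM2r ?exprn_ge0//.
  apply: (@le_trans _ _ (1 + H)); first by rewrite lerDr.
  by rewrite ler_eXnr// lerDl.
have gbar0 : (0 <= gbar (ltnW d21) Sigma (G h) c y)%E.
  by apply: int_cube_ge0 => z _; rewrite lee_fin mulr_ge0// expR_ge0.
apply: abse_div_le.
- exact: V_HK_ge0.
- exact: gbar0.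
- by rewrite mulr_ge0 ?exprn_ge0// mulr_ge0// addr_ge0.
apply: le_trans V_le _; exact: lee_wpmul2r.
Qed.
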